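(* Let $K\ge1$ and let $\boldsymbol{A}\subset\mathbb{R}^{2\times2}$ consist of the following $K+2$ real matrices: $$A_0=\begin{pmatrix}a&b\\ c&d\end{pmatrix},\quad A_i=\begin{pmatrix}a_{ii}&r_ib\\ r_ic&d_{ii}\end{pmatrix}\ (1\le i\le K),\quad B=\begin{pmatrix}b_{11}&r\sqrt{|b|}\\ r\sqrt{|c|}&b_{22}\end{pmatrix},$$ where $a,b,c,d$, $a_{ii},d_{ii}$ $(1\le i\le K)$, $b_{11},b_{22}$, and $r,r_1,\dotsc,r_K$ are real constants. If $bc\ge0$ and $\|B\|\le\max_{0\le i\le K}\rho(A_i)$, then $\boldsymbol{A}$ has the spectral finiteness and moreover $$\boldsymbol{\rho}(\boldsymbol{A})=\max_{0\le k\le K}\rho(A_k).$$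
   Context: $\rho(M)$ is the usual spectral radius of a real square matrix $M$. $\|\cdot\|$ denotes the matrix norm induced by the Euclidean vector norm (the spectral norm, so $\|M\|^2=\rho(M^TM)$). For a finite set $\boldsymbol{A}$ of real square matrices of the same size and $n\ge1$, let $\boldsymbol{A}^n=\{M_1\cdots M_n : M_i\in\boldsymbol{A},\ 1\le i\le n\}$. The generalized spectral radius of $\boldsymbol{A}$ is $$\boldsymbol{\rho}(\boldsymbol{A})=\sup_{n\ge1}\max_{M\in\boldsymbol{A}^n}\rho(M)^{1/n}.$$ $\boldsymbol{A}$ has the spectral finiteness if there exist $n\ge1$ and $M\in\boldsymbol{A}^{n}$ with $\boldsymbol{\rho}(\boldsymbol{A})=\rho(M)^{1/n}$. *)

(* Defs.v *)
From mathcomp Require Import all_boot all_order all_algebra.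
From mathcomp Require Import finmap complex.
From mathcomp Require Import all_classical all_reals all_analysis.

Set Implicit Arguments.
Unset Strict Implicit.
Unset Printing Implicit Defensive.

Import Order.TTheory GRing.Theory Num.Theory.

Local Open Scope classical_set_scope.
Local Open Scope ring_scope.

Definition mx2 (R : realType) (a b c d : R) : 'M[R]_2 :=
  \matrix_(i < 2, j < 2) nth 0 (nth [::] [:: [:: a; b]; [:: c; d]] i) j.

(* Largest modulus of a complex eigenvalue of M.  The library's [eigenvalue]
   refers to left eigenvectors; left and right spectra coincide. *)
Definition spectral_radius (R : realType) (m : nat) (M : 'M[R]_m) : R :=
  sup [set ComplexField.Normc.normc z |
        z in [set z : R[i] | eigenvalue (map_mx (real_complex R) M) z]].

Definition euclidean_norm (R : realType) (m : nat) (x : 'cV[R]_m) : R :=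
  Num.sqrt (\sum_(i < m) x i ord0 ^+ 2).

Definition spectral_norm (R : realType) (m : nat) (M : 'M[R]_m) : R :=
  sup [set euclidean_norm (M *m x) |
        x in [set x : 'cV[R]_m | euclidean_norm x <= 1]].

Definition products (R : realType) (m : nat) (A : {fset 'M[R]_m}) (n : nat) :
    {fset 'M[R]_m} :=
  [fset \prod_(i < n) val ((s : {ffun 'I_n -> A}) i) |
     s in {: {ffun 'I_n -> A}}]%fset.

(* All terms are nonnegative, so the default 0 of the iterated maximum does not
   affect the maximum over a nonempty set of products. *)
Definition generalized_spectral_radius (R : realType) (m : nat)
    (A : {fset 'M[R]_m}) : R :=
  sup [set \big[Num.max/0]_(M <- products A n) (spectral_radius M `^ (n%:R^-1))
        | n in [set n : nat | (1 <= n)%N]].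

Definition spectral_finiteness (R : realType) (m : nat)
    (A : {fset 'M[R]_m}) : Prop :=
  exists n : nat, (1 <= n)%N /\
  exists M : 'M[R]_m, M \in products A n /\
    generalized_spectral_radius A = spectral_radius M `^ (n%:R^-1).

(* Main.v *)
Require Import Defs.
From mathcomp Require Import all_boot all_order all_algebra.
From mathcomp Require Import finmap complex.
From mathcomp Require Import all_classical all_reals all_analysis.
From mathcomp Require Import ring lra.

Set Implicit Arguments.
Unset Strict Implicit.
Unset Printing Implicit Defensive.

Import Order.TTheory GRing.Theory Num.Theory.

Local Open Scope ring_scope.

(* If [0 < b * c], the diagonal similarity that symmetrizes every [A_k]
   transforms [B] into its transpose.  All matrices of the family then become
   contractions of ratio [max_k rho (A_k)] for one Euclidean norm: the norm of a
   symmetric matrix is its spectral radius, and [B^T] has the norm of [B].  If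
   [b * c = 0], the family is simultaneously triangular, and the eigenvalues of a
   product are products of diagonal entries.  In both cases a product of [n]
   matrices has spectral radius at most [(max_k rho (A_k)) ^ n]. *)

Local Notation normc := ComplexField.Normc.normc.

(** * Bounds on the spectral radius *)

Lemma normc_real (R : realType) (x : R) : normc (real_complex R x) = `|x|.
Proof. by rewrite /normc /= expr0n addr0 sqrtr_sqr. Qed.

Lemma sqr_normc (R : realType) (z : R[i]) :
  normc z ^+ 2 = complex.Re z ^+ 2 + complex.Im z ^+ 2.
Proof. by case: z => x y /=; rewrite sqr_sqrtr // addr_ge0 ?sqr_ge0. Qed.

Lemma spectral_radius_le (R : realType) (m : nat) (M : 'M[R]_m) (C : R) :
    0 <= C ->
    (forall z, eigenvalue (map_mx (real_complex R) M) z -> normc z <= C) ->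
  spectral_radius M <= C.
Proof.
move=> C0 hC; rewrite /spectral_radius.
set E := (X in sup X); have [->|/set0P E0] := eqVneq E classical_sets.set0.
  (* Without eigenvalues, as for [m = 0], the supremum takes the default value 0; this is where
     [0 <= C] enters. *)
  by rewrite sup0.
by apply: ge_sup => // _ [z hz <-]; exact: hC.
Qed.

Lemma normc_le_spectral_radius (R : realType) (m : nat) (M : 'M[R]_m) z :
  eigenvalue (map_mx (real_complex R) M) z -> normc z <= spectral_radius M.
Proof.
move=> hz; apply: ub_le_sup; last by exists z.
have [rs] := closed_field_poly_normal (char_poly (map_mx (real_complex R) M)).
rewrite (monicP (char_poly_monic _)) scale1r => rsE.
(* The eigenvalues are the roots [rs] of the characteristic polynomial, so the sum of their moduli
   bounds each of them and the supremum is a genuine one. *)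
exists (\sum_(y <- rs) normc y) => _ [y /= + <-].
rewrite eigenvalue_root_char rsE root_prod_XsubC => yrs.
rewrite (big_rem _ yrs) /= lerDl sumr_ge0 // => i _.
by case: i => ? ?; exact: sqrtr_ge0.
Qed.

Lemma spectral_radius_ge0 (R : realType) (m : nat) (M : 'M[R]_m) :
  0 <= spectral_radius M.
Proof.
rewrite /spectral_radius.
set E := (X in sup X).
have [->|/set0P[_ [z hz _]]] := eqVneq E classical_sets.set0.
  by rewrite sup0.
apply: le_trans (normc_le_spectral_radius hz).
by case: z {hz} => ? ?; exact: sqrtr_ge0.
Qed.

(** It acts on row vectors because [eigenvalue] refers to left eigenvectors. *)
Definition weighted_sqnorm (R : realType) (m : nat) (w : 'I_m -> R)
  (v : 'rV[R]_m) : R := \sum_j w j * v ord0 j ^+ 2.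

(* Eigenvectors are split into real and imaginary parts, whose squared norms
   add up. *)
Lemma spectral_radius_le_weighted (R : realType) (m : nat) (w : 'I_m -> R)
    (M : 'M[R]_m) (C : R) :
    (forall j, 0 < w j) -> 0 <= C ->
    (forall v, weighted_sqnorm w (v *m M) <= C ^+ 2 * weighted_sqnorm w v) ->
  spectral_radius M <= C.
Proof.
move=> w0 C0 hM; apply: spectral_radius_le => // z /eigenvalueP[v vM v0].
pose x := \row_j complex.Re (v ord0 j); pose y := \row_j complex.Im (v ord0 j).
pose S := \sum_j w j * normc (v ord0 j) ^+ 2.
have SE : weighted_sqnorm w x + weighted_sqnorm w y = S.
  rewrite -big_split; apply: eq_bigr => j _ /=.
  by rewrite !mxE sqr_normc mulrDr.
have S0 : 0 < S.
  have [j vj] : exists j, v ord0 j != 0 by exact/rV0Pn.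
  rewrite /S (bigD1 j) //= ltr_pwDl //.
    rewrite mulr_gt0 // exprn_gt0 // lt0r.
    rewrite (contra_neq (@ComplexField.Normc.eq0_normc _ _) vj) /=.
    by case: (v ord0 j) => ? ?; exact: sqrtr_ge0.
  by apply: sumr_ge0 => i _; rewrite mulr_ge0 ?sqr_ge0 ?ltW.
(* As [M] is real, [x *m M] and [y *m M] are the real and imaginary parts of [z *: v]. *)
have MS : weighted_sqnorm w (x *m M) + weighted_sqnorm w (y *m M)
    = normc z ^+ 2 * S.
  rewrite -big_split mulr_sumr; apply: eq_bigr => j _ /=.
  have vMj := congr1 (fun u : 'rV_m => u ord0 j) vM.
  have -> : (x *m M) ord0 j = complex.Re (z * v ord0 j).
    move: vMj; rewrite !mxE => <-.
    rewrite (raddf_sum (@complex.Re R)); apply: eq_bigr => i _.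
    by rewrite !mxE; case: (v ord0 i) => p q /=; rewrite mulr0 subr0.
  have -> : (y *m M) ord0 j = complex.Im (z * v ord0 j).
    move: vMj; rewrite !mxE => <-.
    rewrite (raddf_sum (@complex.Im R)); apply: eq_bigr => i _.
    by rewrite !mxE; case: (v ord0 i) => p q /=; rewrite mulr0 add0r.
  by rewrite !sqr_normc; case: z {vM vMj} (v ord0 j) => p q [s t] /=; ring.
have : normc z ^+ 2 * S <= C ^+ 2 * S.
  by rewrite -MS -SE mulrDr lerD.
rewrite ler_pM2r // ler_sqr // nnegrE.
by case: z {vM MS} => ? ?; exact: sqrtr_ge0.
Qed.

(** * Products and attainment of the generalized spectral radius *)

Lemma mem_products1 (R : realType) (m : nat) (A : {fset 'M[R]_m}) M :
  M \in A -> M \in products A 1.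
Proof.
move=> MA; apply/imfsetP; exists [ffun=> FSetSub MA] => //=.
by rewrite big_ord1 ffunE.
Qed.

(** New factors come on the right, so that in [v *m (M * N)] the factor [N] acts on the row
    [v *m M], already estimated. *)
Lemma products_ind (R : realType) (m : nat) (A : {fset 'M[R]_m})
    (P : nat -> 'M[R]_m -> Prop) :
    P 0 1 ->
    (forall n M N, P n M -> N \in A -> P n.+1 (M * N)) ->
  forall n M, M \in products A n -> P n M.
Proof.
move=> P0 PS n M /imfsetP[/= s _ ->].
elim: n s => [|n IHn] s; first by rewrite big_ord0.
rewrite big_ord_recr /=; apply: PS (valP _).
have := IHn [ffun i => s (widen_ord (leqnSn n) i)].
by under eq_bigr => i _ do rewrite ffunE.
Qed.

(** The product [M0] of length 1 attains the value, and [n]-th roots of the hypothesis bound every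
    term of the supremum. *)
Lemma spectral_finiteness_attained (R : realType) (m : nat)
    (A : {fset 'M[R]_m}) (M0 : 'M[R]_m) :
    M0 \in A ->
    (forall n M, M \in products A n ->
       spectral_radius M <= spectral_radius M0 ^+ n) ->
  spectral_finiteness A /\ generalized_spectral_radius A = spectral_radius M0.
Proof.
move=> M0A hA.
have M01 : M0 \in products A 1 by exact: mem_products1.
have rho1 : spectral_radius M0 `^ 1%:R^-1 = spectral_radius M0.
  by rewrite invr1 powRr1 // spectral_radius_ge0.
suff gsrE : generalized_spectral_radius A = spectral_radius M0.
  by split=> //; exists 1%N; split=> //; exists M0; rewrite gsrE rho1.
have ub : ubound [set \big[Num.max/0]_(M <- products A n)
                        (spectral_radius M `^ (n%:R^-1))
                 | n in [set n : nat | (1 <= n)%N]]%classic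
                 (spectral_radius M0).
  move=> _ [n /= n0 <-]; rewrite big_seq.
  apply: bigmax_le => [|M MA]; first exact: spectral_radius_ge0.
  have -> : spectral_radius M0 = (spectral_radius M0 ^+ n) `^ n%:R^-1.
    rewrite -powR_mulrn ?spectral_radius_ge0 // -powRrM mulfV ?powRr1 //.
      exact: spectral_radius_ge0.
    by rewrite pnatr_eq0 -lt0n.
  by rewrite ge0_ler_powR ?invr_ge0 ?nnegrE ?exprn_ge0 ?spectral_radius_ge0 ?hA.
apply/eqP; rewrite eq_le; apply/andP; split.
  by apply: ge_sup => //; eexists; exists 1%N.
have h1 : spectral_radius M0 <=
    \big[Num.max/0]_(M <- products A 1) (spectral_radius M `^ (1%:R^-1)).
  rewrite -[leLHS]rho1.
  exact: (le_bigmax_seq 0 M0 xpredT (fun M => spectral_radius M `^ _)).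
apply: le_trans h1 _; apply: ub_le_sup; first by exists (spectral_radius M0).
by exists 1%N.
Qed.

(** * The spectral norm *)

Lemma spectral_norm_bound (R : realType) (m : nat) (M : 'M[R]_m) x :
  euclidean_norm (M *m x) <= spectral_norm M * euclidean_norm x.
Proof.
have normZ k (y : 'cV[R]_m) : 0 <= k ->
    euclidean_norm (k *: y) = k * euclidean_norm y.
  move=> k0; rewrite /euclidean_norm -[in RHS](ger0_norm k0) -sqrtr_sqr.
  rewrite -sqrtrM ?sqr_ge0 // mulr_sumr; congr Num.sqrt.
  by apply: eq_bigr => i _; rewrite mxE exprMn.
have coord (y : 'cV[R]_m) j : `|y j ord0| <= euclidean_norm y.
  rewrite -sqrtr_sqr ler_wsqrtr // (bigD1 j) //= lerDl sumr_ge0 // => i _.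
  exact: sqr_ge0.
have bounded : has_ubound [set euclidean_norm (M *m x) |
    x in [set x : 'cV[R]_m | euclidean_norm x <= 1]]%classic.
  (* Coordinates of a vector in the unit ball have modulus at most 1, so each coordinate of its
     image is at most an absolute row sum. *)
  exists (Num.sqrt (\sum_i (\sum_j `|M i j|) ^+ 2)) => _ [y /= y1 <-].
  apply: ler_wsqrtr; apply: ler_sum => i _; rewrite mxE -real_normK ?num_real //.
  rewrite ler_sqr ?nnegrE ?sumr_ge0 //; apply: le_trans (ler_norm_sum _ _ _) _.
  apply: ler_sum => j _; rewrite normrM ler_piMr //.
  exact: le_trans (coord y j) y1.
have [x0|x0] := eqVneq (euclidean_norm x) 0.
  have -> : x = 0.
    apply/colP => j; apply/eqP; rewrite mxE -normr_le0 -x0; exact: coord.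
  rewrite mulmx0 /euclidean_norm big1 ?sqrtr0 ?mulr0 // => i _.
  by rewrite mxE expr0n.
have xgt0 : 0 < euclidean_norm x by rewrite lt0r x0 sqrtr_ge0.
have inv0 : 0 <= (euclidean_norm x)^-1 by rewrite invr_ge0 ltW.
rewrite -ler_pdivrMr // mulrC -normZ // scalemxAr.
rewrite /spectral_norm; apply: ub_le_sup => //; exists ((euclidean_norm x)^-1 *: x) => //=.
by rewrite normZ // mulVf.
Qed.

(** The image of the [k]-th unit vector is column [k], which is at least as long as its entry
    [M k k]. *)
Lemma diag_le_spectral_norm (R : realType) (m : nat) (M : 'M[R]_m) k :
  `|M k k| <= spectral_norm M.
Proof.
have := spectral_norm_bound M (delta_mx k ord0).
have -> : euclidean_norm (delta_mx k ord0 : 'cV[R]_m) = 1.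
  rewrite /euclidean_norm (bigD1 k) //= big1 ?mxE ?eqxx ?expr1n ?addr0 ?sqrtr1 //.
  by move=> i ik; rewrite mxE (negPf ik) expr0n.
rewrite mulr1; apply: le_trans.
rewrite -colE -sqrtr_sqr ler_wsqrtr // (bigD1 k) //= mxE lerDl sumr_ge0 // => i _.
exact: sqr_ge0.
Qed.

(** * Triangular matrices of size 2 *)

Lemma ord2_pred2 (i j k : 'I_2) : i != j -> (k == i) || (k == j).
Proof. by move: i j k; do 3![case=> [[|[|//]] ?]]. Qed.

Lemma sum_ord2 (V : nmodType) (i j : 'I_2) (F : 'I_2 -> V) :
  i != j -> \sum_k F k = F i + F j.
Proof.
move=> ij; rewrite (bigD1 i) //= (bigD1 j) 1?eq_sym //= big1 ?addr0 // => k.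
by rewrite -negb_or ord2_pred2.
Qed.

(** Arbitrary distinct [i] and [j] cover both triangular shapes. For a left eigenvector [v],
    coordinate [j] of [v *m M] involves only [M j j], which gives [z = M j j] unless [v] vanishes
    there; in that case coordinate [i] gives [z = M i i]. *)
Lemma spectral_radius_le_diag (R : realType) (i j : 'I_2) (M : 'M[R]_2) C :
    i != j -> M i j = 0 -> (forall k, `|M k k| <= C) -> spectral_radius M <= C.
Proof.
move=> ij Mij hC; apply: spectral_radius_le => [|z /eigenvalueP[v vM v0]].
  exact: le_trans (hC i).
have vMk k := congr1 (fun u : 'rV_2 => u ord0 k) vM.
suff [k ->] : exists k, z = real_complex R (M k k) by rewrite normc_real.
have [vj0|vj0] := eqVneq (v ord0 j) 0.
  exists i; apply: (@mulIf _ (v ord0 i)).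
    apply: contra_neq v0 => vi0; apply/rowP => k; rewrite mxE.
    by have /pred2P[->|->] := ord2_pred2 k ij.
  have := vMk i; rewrite !mxE (sum_ord2 _ ij) !mxE vj0 mul0r addr0 => <-.
  exact: mulrC.
exists j; apply: (@mulIf _ (v ord0 j)) => //.
have := vMk j; rewrite !mxE (sum_ord2 _ ij) !mxE Mij rmorph0 mulr0 add0r => <-.
exact: mulrC.
Qed.

Lemma products_diag (R : realType) (i j : 'I_2) (A : {fset 'M[R]_2}) C :
    i != j ->
    (forall M, M \in A -> M i j = 0 /\ forall k, `|M k k| <= C) ->
  forall n M, M \in products A n -> M i j = 0 /\ forall k, `|M k k| <= C ^+ n.
Proof.
move=> ij hA.
apply: (products_ind (P := fun n (M : 'M[R]_2) =>
  M i j = 0 /\ forall k, `|M k k| <= C ^+ n)).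
  split=> [|k]; first by rewrite mxE (negPf ij).
  by rewrite mxE eqxx normr1.
move=> n M N [Mij Mkk] /hA[Nij Nkk]; split=> [|k].
  by rewrite mxE (sum_ord2 _ ij) Mij Nij mulr0 mul0r addr0.
have -> : (M * N) k k = M k k * N k k.
  have /pred2P[->|->] := ord2_pred2 k ij.
  - by rewrite mxE (sum_ord2 _ ij) Mij mul0r addr0.
  - by rewrite mxE (sum_ord2 _ ij) Nij mulr0 add0r.
by rewrite normrM exprSr ler_pM.
Qed.

(** * Weighted contractions and symmetrizable matrices of size 2 *)

Lemma products_weighted (R : realType) (m : nat) (w : 'I_m -> R)
    (A : {fset 'M[R]_m}) C :
    (forall M, M \in A -> forall v,
       weighted_sqnorm w (v *m M) <= C ^+ 2 * weighted_sqnorm w v) ->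
  forall n M, M \in products A n -> forall v,
    weighted_sqnorm w (v *m M) <= (C ^+ n) ^+ 2 * weighted_sqnorm w v.
Proof.
move=> hA.
apply: (products_ind (P := fun n (M : 'M[R]_m) => forall v,
    weighted_sqnorm w (v *m M) <= (C ^+ n) ^+ 2 * weighted_sqnorm w v)).
  by move=> v; rewrite mulmx1 expr0 expr1n mul1r.
move=> n M N hM /hA hN v.
rewrite mulmxA; apply: le_trans (hN _) _.
by rewrite [C ^+ n.+1]exprS exprMn -(mulrA (C ^+ 2)) ler_wpM2l ?sqr_ge0.
Qed.

(** The ratio is the larger eigenvalue modulus of the symmetric matrix with rows (p, q) and (q, s).
    That matrix is [m] times the identity plus a trace-free part whose square is [t ^+ 2] times the
    identity; [T] is the quadratic form of the trace-free part. *)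
Lemma mx2_symmetric_contraction (R : realType) (p q s x y : R) :
  (p * x + q * y) ^+ 2 + (q * x + s * y) ^+ 2 <=
  (`|(p + s) / 2| + Num.sqrt (((p - s) / 2) ^+ 2 + q ^+ 2)) ^+ 2
    * (x ^+ 2 + y ^+ 2).
Proof.
set m := (p + s) / 2; set h := (p - s) / 2; set t := Num.sqrt _.
have t0 : 0 <= t by exact: sqrtr_ge0.
have tE : t ^+ 2 = h ^+ 2 + q ^+ 2 by rewrite sqr_sqrtr // addr_ge0 ?sqr_ge0.
have -> : p = m + h by rewrite /m /h; field.
have -> : s = m - h by rewrite /m /h; field.
pose N := x ^+ 2 + y ^+ 2; pose T := h * (x ^+ 2 - y ^+ 2) + 2 * q * x * y.
have N0 : 0 <= N by rewrite addr_ge0 ?sqr_ge0.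
have TN : `|T| <= t * N.
  rewrite -ler_sqr ?nnegrE ?mulr_ge0 // real_normK ?num_real // exprMn tE.
  rewrite -subr_ge0.
  (* Lagrange's identity for the vectors (h, q) and (x^2 - y^2, 2xy), the second of which has length
     [N]. *)
  have -> : (h ^+ 2 + q ^+ 2) * N ^+ 2 - T ^+ 2
    = (2 * h * x * y - q * (x ^+ 2 - y ^+ 2)) ^+ 2 by rewrite /N /T; ring.
  exact: sqr_ge0.
have mT : m * T <= `|m| * (t * N).
  by apply: le_trans (ler_norm _) _; rewrite normrM ler_wpM2l.
have -> : ((m + h) * x + q * y) ^+ 2 + (q * x + (m - h) * y) ^+ 2
    = m ^+ 2 * N + 2 * (m * T) + (h ^+ 2 + q ^+ 2) * N by rewrite /N /T; ring.
have -> : (`|m| + t) ^+ 2 * N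
    = `|m| ^+ 2 * N + 2 * (`|m| * (t * N)) + t ^+ 2 * N by ring.
rewrite real_normK ?num_real // tE; lra.
Qed.

Lemma det_mx2 (R : comPzRingType) (M : 'M[R]_2) :
  \det M = M 0 0 * M 1 1 - M 0 1 * M 1 0.
Proof.
rewrite (expand_det_row _ 0) big_ord_recl big_ord1 /cofactor !det_mx11 !mxE /=.
rewrite expr0 expr1 mul1r mulN1r mulrN.
by congr (_ * M _ _ - M _ _ * M _ _); apply/val_inj.
Qed.

(** As [0 <= u * v], the eigenvalues [m + t] and [m - t] are real; the sign of [m] decides which one
    has the larger modulus. *)
Lemma mx2_le_spectral_radius (R : realType) (p u v s : R) :
    0 <= u * v ->
  `|(p + s) / 2| + Num.sqrt (((p - s) / 2) ^+ 2 + u * v) <=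
    spectral_radius (mx2 p u v s).
Proof.
move=> uv0; set m := (p + s) / 2; set h := (p - s) / 2; set t := Num.sqrt _.
have t0 : 0 <= t by exact: sqrtr_ge0.
have tE : t ^+ 2 = h ^+ 2 + u * v by rewrite sqr_sqrtr // addr_ge0 ?sqr_ge0.
have eig l : (p - l) * (s - l) = u * v ->
    `|l| <= spectral_radius (mx2 p u v s).
  move=> hl; rewrite -normc_real; apply: normc_le_spectral_radius.
  rewrite /eigenvalue /eigenspace kermx_eq0 row_free_unit unitmxE unitfE negbK.
  rewrite -map_scalar_mx -map_mxB det_map_mx det_mx2 !mxE /=.
  by rewrite !mulr1n !mulr0n !subr0 hl subrr rmorph0.
have [m0|m0] := ger0P m.
  rewrite -(ger0_norm (addr_ge0 m0 t0)); apply: eig.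
  have -> : (p - (m + t)) * (s - (m + t)) = t ^+ 2 - h ^+ 2.
    by rewrite /m /h; field.
  by rewrite tE addrC addKr.
have -> : - m + t = `|m - t| by rewrite ltr0_norm; lra.
apply: eig.
have -> : (p - (m - t)) * (s - (m - t)) = t ^+ 2 - h ^+ 2.
  by rewrite /m /h; field.
by rewrite tE addrC addKr.
Qed.

(** The diagonal entries are [m + h] and [m - h], and the modulus of [h] is at most the square root
    in the eigenvalue formula. *)
Lemma mx2_diag_le_spectral_radius (R : realType) (p u v s : R) k :
  0 <= u * v -> `|mx2 p u v s k k| <= spectral_radius (mx2 p u v s).
Proof.
move=> uv0; apply: le_trans (mx2_le_spectral_radius p s uv0).
set m := (p + s) / 2; set h := (p - s) / 2.
have ht : `|h| <= Num.sqrt (h ^+ 2 + u * v).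
  by rewrite -sqrtr_sqr ler_wsqrtr // lerDl.
suff : `|mx2 p u v s k k| <= `|m| + `|h|.
  by move/le_trans; apply; rewrite lerD2l.
case: k => [[|[|//]] ?]; rewrite mxE /=.
  by rewrite (_ : p = m + h) ?ler_normD // /m /h; field.
by rewrite (_ : s = m - h) ?ler_normB // /m /h; field.
Qed.

(* Rescaling [(x, y)] to [(Num.sqrt `|b| * x, Num.sqrt `|c| * y)] turns right
   multiplication by [A_k] into a symmetric map when [0 < b * c], and right
   multiplication by [B] into [B] acting on column vectors. *)
Definition symm_weight (R : realType) (b c : R) (j : 'I_2) : R :=
  if j == ord0 then `|b| else `|c|.

Lemma weighted_sqnorm_mx2 (R : realType) (b c p u v s : R) (x : 'rV[R]_2) :
  weighted_sqnorm (symm_weight b c)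
    (x *m mx2 p u v s) =
  `|b| * (p * x 0 0 + v * x 0 1) ^+ 2 + `|c| * (u * x 0 0 + s * x 0 1) ^+ 2.
Proof.
rewrite /weighted_sqnorm /symm_weight big_ord_recl big_ord1 /= !mxE.
rewrite !big_ord_recl !big_ord0 !mxE /= !addr0.
by rewrite (_ : lift ord0 ord0 = 1) ?(mulrC (x 0 _)) //; apply/val_inj.
Qed.

Lemma weighted_sqnorm2 (R : realType) (b c : R) (x : 'rV[R]_2) :
  weighted_sqnorm (symm_weight b c) x =
  (Num.sqrt `|b| * x 0 0) ^+ 2 + (Num.sqrt `|c| * x 0 1) ^+ 2.
Proof.
rewrite /weighted_sqnorm /symm_weight big_ord_recl big_ord1 /= !exprMn !sqr_sqrtr //.
by rewrite (_ : lift ord0 ord0 = 1) //; apply/val_inj.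
Qed.

Lemma proportional_mx2_contraction (R : realType) (b c p r s : R) x :
  0 < b * c ->
  weighted_sqnorm (symm_weight b c)
    (x *m mx2 p (r * b) (r * c) s) <=
  spectral_radius (mx2 p (r * b) (r * c) s) ^+ 2 *
    weighted_sqnorm (symm_weight b c) x.
Proof.
move=> bc0; rewrite weighted_sqnorm_mx2 weighted_sqnorm2.
have b0 : b != 0 by apply: contraTneq bc0 => ->; rewrite mul0r ltxx.
have sgbc : Num.sg c = Num.sg b.
  apply: (mulfI (x := Num.sg b)); rewrite ?sgr_eq0 //.
  by rewrite -sgrM gtr0_sg // -expr2 sqr_sg b0.
set beta := Num.sqrt `|b|; set gamma := Num.sqrt `|c|.
have bE : `|b| = beta ^+ 2 by rewrite sqr_sqrtr.
have cE : `|c| = gamma ^+ 2 by rewrite sqr_sqrtr.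
have rb : r * b = r * (Num.sg b * beta ^+ 2) by rewrite -bE -numEsg.
have rc : r * c = r * (Num.sg b * gamma ^+ 2) by rewrite -cE -sgbc -numEsg.
have uv0 : 0 <= (r * b) * (r * c).
  by rewrite mulrACA -expr2 mulr_ge0 ?sqr_ge0 ?ltW.
set rho := spectral_radius _.
(* Both off-diagonal entries become [q] after rescaling by [beta] and [gamma], because [b] and [c]
   have the same sign. *)
pose q := r * Num.sg b * beta * gamma.
have q2 : q ^+ 2 = (r * b) * (r * c).
  by rewrite rb rc /q; ring.
have -> : `|b| * (p * x 0 0 + r * c * x 0 1) ^+ 2
        + `|c| * (r * b * x 0 0 + s * x 0 1) ^+ 2
    = (p * (beta * x 0 0) + q * (gamma * x 0 1)) ^+ 2
      + (q * (beta * x 0 0) + s * (gamma * x 0 1)) ^+ 2.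
  by rewrite rb rc bE cE /q; ring.
apply: le_trans (mx2_symmetric_contraction _ _ _ _ _) _.
rewrite ler_wpM2r ?addr_ge0 ?sqr_ge0 // ler_sqr ?nnegrE ?spectral_radius_ge0 //.
by rewrite q2; exact: mx2_le_spectral_radius.
Qed.

Lemma sqrt_mx2_contraction (R : realType) (b c b11 b22 r : R) B x :
  B = mx2 b11 (r * Num.sqrt `|b|) (r * Num.sqrt `|c|) b22 ->
  weighted_sqnorm (symm_weight b c) (x *m B)
  <= spectral_norm B ^+ 2 *
    weighted_sqnorm (symm_weight b c) x.
Proof.
move=> BE; rewrite {1}BE weighted_sqnorm_mx2 weighted_sqnorm2.
set beta := Num.sqrt `|b|; set gamma := Num.sqrt `|c|.
have bE : `|b| = beta ^+ 2 by rewrite sqr_sqrtr.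
have cE : `|c| = gamma ^+ 2 by rewrite sqr_sqrtr.
pose X : 'cV[R]_2 := \col_j if j == ord0 then beta * x 0 0 else gamma * x 0 1.
have := spectral_norm_bound B X.
rewrite -ler_sqr ?nnegrE ?sqrtr_ge0 //; last first.
  by rewrite mulr_ge0 ?sqrtr_ge0 // (le_trans _ (diag_le_spectral_norm B 0)).
rewrite {1}BE exprMn !sqr_sqrtr ?sumr_ge0 // => [|i _|i _]; try exact: sqr_ge0.
rewrite !big_ord_recl !big_ord0 !mxE !big_ord_recl !big_ord0 !mxE /= !addr0.
(* The rescaled coordinates of [x *m B] are exactly the entries of [B *m X]: the weights move [beta]
   and [gamma] across the diagonal of [B]. *)
apply: le_trans; rewrite le_eqVlt; apply/orP; left; apply/eqP.
by rewrite -/beta -/gamma bE cE; ring.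
Qed.

Theorem corollary3 (R : realType) (K : nat) (hK : (1 <= K)%N)
    (a b c d : R) (a_ d_ r_ : 'I_K -> R) (b11 b22 r : R)
    (A : 'I_K.+1 -> 'M[R]_2) (B : 'M[R]_2)
    (hA0 : A ord0 = mx2 a b c d)
    (hA : forall i : 'I_K,
       A (lift ord0 i) = mx2 (a_ i) (r_ i * b) (r_ i * c) (d_ i))
    (hB : B = mx2 b11 (r * Num.sqrt `|b|) (r * Num.sqrt `|c|) b22)
    (hbc : 0 <= b * c)
    (hnorm : spectral_norm B <=
       \big[Num.max/spectral_radius (A ord0)]_(k < K.+1) spectral_radius (A k)) :
  let AA : {fset 'M[R]_2} := ([fset A k | k in 'I_K.+1] `|` [fset B])%fset in
  spectral_finiteness AA /\
  generalized_spectral_radius AA =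
    \big[Num.max/spectral_radius (A ord0)]_(k < K.+1) spectral_radius (A k).
Proof.
move=> AA; set rho := \big[_/_]_(_ < _) _ in hnorm *.
have le_rho k : spectral_radius (A k) <= rho by exact: le_bigmax.
(* The starting value of the maximum is itself one of the radii, so the maximum is attained. *)
have [k0 rhoE] : exists k, rho = spectral_radius (A k).
  rewrite /rho; apply: (big_ind (fun y => exists k, y = spectral_radius (A k))).
  - by exists ord0.
  - by move=> y z Hy Hz; rewrite maxEle; case: ifP.
  - by move=> k _; exists k.
have rho0 : 0 <= rho by rewrite rhoE spectral_radius_ge0.
have Ak0 : A k0 \in AA by rewrite !inE; apply/orP; left; apply/imfsetP; exists k0.
have hAk k : exists p t s, A k = mx2 p (t * b) (t * c) s.
  case: (unliftP ord0 k) => [i ->|->]; first by do 3!eexists; exact: hA.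
  (* [A ord0] has the common shape with factor 1. *)
  by exists a, 1, d; rewrite !mul1r.
have normB0 : 0 <= spectral_norm B.
  exact: le_trans (normr_ge0 _) (diag_le_spectral_norm B 0).
have memAA (P : 'M[R]_2 -> Prop) :
    (forall k, P (A k)) -> P B -> forall M, M \in AA -> P M.
  move=> PA PB M; rewrite inE => /orP[/imfsetP[k _ ->]//|].
  by rewrite inE => /eqP ->.
rewrite rhoE; apply: spectral_finiteness_attained => //; rewrite -rhoE.
(* When [b * c = 0] a weight vanishes and the weighted norm degenerates; the triangular argument
   takes over. *)
move: (hbc); rewrite le_eqVlt => /predU1P[/esym/eqP|bc0].
  have diagAA : forall M, M \in AA -> forall k, `|M k k| <= rho.
    apply: memAA => [i k|k]; last exact: le_trans (diag_le_spectral_norm B k) _.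
    have := le_rho i; have [p [t [s ->]]] := hAk i; apply: le_trans.
    apply: mx2_diag_le_spectral_radius.
    by rewrite mulrACA -expr2 mulr_ge0 ?sqr_ge0.
  have triangular (i j : 'I_2) : i != j -> (forall M, M \in AA -> M i j = 0) ->
      forall n M, M \in products AA n -> spectral_radius M <= rho ^+ n.
    move=> ij AAij n M /(products_diag (C := rho) ij)[|Mij Mkk].
      by move=> N NAA; split; [exact: AAij | exact: diagAA].
    exact: (spectral_radius_le_diag ij).
  (* The vanishing constant also kills the matching entry of [B], through its square root. *)
  rewrite mulf_eq0 => /orP[]/eqP z0.
    apply: (triangular 0 1) => //; apply: memAA => [k|].
      by have [p [t [s ->]]] := hAk k; rewrite mxE /= z0 mulr0.
    by rewrite hB mxE /= z0 normr0 sqrtr0 mulr0.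
  apply: (triangular 1 0) => //; apply: memAA => [k|].
    by have [p [t [s ->]]] := hAk k; rewrite mxE /= z0 mulr0.
  by rewrite hB mxE /= z0 normr0 sqrtr0 mulr0.
pose w := symm_weight b c.
have w0 j : 0 < w j.
  by rewrite /w /symm_weight; case: ifP => _; rewrite normr_gt0;
    apply: contraTneq bc0 => ->; rewrite ?mul0r ?mulr0 ltxx.
have wn0 v : 0 <= weighted_sqnorm w v.
  by apply: sumr_ge0 => j _; rewrite mulr_ge0 ?sqr_ge0 ?ltW.
move=> n M MAA; apply: (spectral_radius_le_weighted w0); first exact: exprn_ge0.
apply: products_weighted MAA; apply: memAA => [k|] v.
  apply: (@le_trans _ _ (spectral_radius (A k) ^+ 2 * weighted_sqnorm w v)).
    have [p [t [s ->]]] := hAk k; exact: proportional_mx2_contraction.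
  by rewrite ler_wpM2r // ler_sqr ?nnegrE ?spectral_radius_ge0.
apply: (@le_trans _ _ (spectral_norm B ^+ 2 * weighted_sqnorm w v)).
  exact: sqrt_mx2_contraction hB.
by rewrite ler_wpM2r // ler_sqr ?nnegrE.
Qed.
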